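(* Let $N\ge 1$, $d\geq 1$ and $p\ge N$ be integers. Let $\sim$ be an equivalence relation on $\{1,\dots,N\}$, and let $\phi_1^*,\dots,\phi_N^*\in\mathbb{R}^p$ be vectors with $\|\phi_i^*\|=1$ for all $i$ such that $\phi_i^{*T}\phi_j^*=1$ if $i\sim j$ and $\phi_i^{*T}\phi_j^*=0$ otherwise. Let $\phi_1,\dots,\phi_N\in\mathbb{R}^d$ be arbitrary vectors with $\|\phi_i\|=1$ for all $i$. Put $\Phi^*=[\phi_1^*,\dots,\phi_N^*]$, $\Sigma^*=\Phi^{*T}\Phi^*$, $\Phi=[\phi_1,\dots,\phi_N]$, $\Sigma=\Phi^T\Phi$. Let $\lambda_1^*\ge\cdots\ge\lambda_N^*\ge 0$ and $\lambda_1\ge\cdots\ge\lambda_N\ge 0$ be the eigenvalues (counted with multiplicity) of $\Sigma^*$ and $\Sigma$ respectively, and set $$\epsilon=\max_{1\le i,j\le N}\bigl|\phi_i^T\phi_j-\phi_i^{*T}\phi_j^*\bigr| .$$ Then $\epsilon\in[0,2]$, and for every $i\in\{1,\dots,N\}$, $$\delta_i:=\lambda_i-\lambda_i^*\in\bigl[-\sqrt{N(N-1)}\,\epsilon,\ \sqrt{N(N-1)}\,\epsilon\bigr].$$ Moreover, $\sum_{i=1}^N\delta_i=0$.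
   Context: The index $i\in\{1,\dots,N\}$ labels the $i$-th generated answer $y^{(i)}$ in a set of $N$ answers, and $i\sim j$ means that $y^{(i)}$ and $y^{(j)}$ share the same meaning. The vectors $\phi_i^*$ are normalized embeddings of the answers under an ideal sentence encoder, and the vectors $\phi_i$ are normalized embeddings under an actual external sentence encoder; $\Sigma^*$ and $\Sigma$ are the corresponding $N\times N$ Gram matrices. The dimensions $p$ and $d$ may differ. All norms are Euclidean. *)

(* Defs.v *)
From HB Require Import structures.
From mathcomp Require Import all_boot all_order all_algebra.
From mathcomp Require Import reals.

Set Implicit Arguments.
Unset Strict Implicit.
Unset Printing Implicit Defensive.

Import Order.TTheory GRing.Theory Num.Theory.

Local Open Scope ring_scope.

Definition dot (R : realType) (n : nat) (u v : 'cV[R]_n) : R :=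
  (u^T *m v) 0 0.

(* MathComp-Analysis norms matrices by the sup norm, hence this definition. *)
Definition l2norm (R : realType) (n : nat) (u : 'cV[R]_n) : R :=
  Num.sqrt (\sum_(k < n) u k 0 ^+ 2).

Definition cols_mx (R : realType) (n N : nat) (phi : 'I_N -> 'cV[R]_n) :
    'M[R]_(n, N) :=
  \matrix_(k < n, i < N) phi i k 0.

Definition gram (R : realType) (n N : nat) (phi : 'I_N -> 'cV[R]_n) :
    'M[R]_N :=
  (cols_mx phi)^T *m cols_mx phi.

(* [lam] lists the eigenvalues of [A] in nonincreasing order, each repeated
   according to its multiplicity as a root of the characteristic polynomial.
   Such a [lam] is unique; it exists whenever [A] is symmetric. *)
Definition ordered_eigenvalues (R : realType) (N : nat) (A : 'M[R]_N)
    (lam : 'I_N -> R) : Prop :=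
  (forall i j : 'I_N, (i <= j)%N -> lam j <= lam i) /\
  char_poly A = \prod_(i < N) ('X - (lam i)%:P).

(* The default value 0 of the iterated maximum is harmless: the terms are
   nonnegative. *)
Definition gram_error (R : realType) (p d N : nat)
    (phis : 'I_N -> 'cV[R]_p) (phi : 'I_N -> 'cV[R]_d) : R :=
  \big[Num.max/0]_(i < N) \big[Num.max/0]_(j < N)
    `|dot (phi i) (phi j) - dot (phis i) (phis j)|.

(* Main.v *)
(** Both Gram matrices have unit diagonal, so their traces agree and
    [E = Sigma - Sigma^*] has zero diagonal and entries bounded by [eps]; by
    AM-GM, [x E x^T <= (N - 1) eps |x|^2].  Weyl's inequality turns this into
    [|lam_i - lam^*_i| <= (N - 1) eps], and [N - 1 <= sqrt (N (N - 1))]. *)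

Require Import Defs.
From HB Require Import structures.
From mathcomp Require Import all_boot all_order all_algebra.
From mathcomp Require Import reals.
From mathcomp Require Import ring lra.

Set Implicit Arguments.
Unset Strict Implicit.
Unset Printing Implicit Defensive.

Import Order.TTheory GRing.Theory Num.Theory.

Local Open Scope ring_scope.

(** * Orthogonal diagonalization of real symmetric matrices *)

Lemma char_poly_similar (R : comNzRingType) (n : nat) (A U V : 'M[R]_n) :
  U *m V = 1%:M -> char_poly (U *m A *m V) = char_poly A.
Proof.
move=> UV; rewrite /char_poly.
(* The scalar part ['X%:M] is unchanged by the conjugation because [U *m V = 1%:M]. *)
have -> : char_poly_mx (U *m A *m V) =
    map_mx polyC U *m char_poly_mx A *m map_mx polyC V.
  rewrite /char_poly_mx mulmxBr mulmxBl !map_mxM mul_mx_scalar -scalemxAl.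
  by rewrite -[map_mx _ U *m map_mx _ V]map_mxM UV map_mx1 scalemx1.
by rewrite !det_mulmx mulrAC -det_mulmx -map_mxM UV map_mx1 det1 mul1r.
Qed.

Lemma dot_rowE (R : pzRingType) (n : nat) (x y : 'rV[R]_n) :
  (x *m y^T) 0 0 = \sum_i x 0 i * y 0 i.
Proof. by rewrite mxE; apply: eq_bigr => i _; rewrite mxE. Qed.

Lemma sqnorm_gt0 (R : realDomainType) (n : nat) (x : 'rV[R]_n) :
  x != 0 -> 0 < (x *m x^T) 0 0.
Proof.
move=> x0; rewrite dot_rowE lt0r sumr_ge0 ?andbT; last first.
  by move=> i _; rewrite -expr2 sqr_ge0.
apply: contra x0; rewrite psumr_eq0 => [|i _]; last by rewrite -expr2 sqr_ge0.
move=> /allP x0; apply/eqP/rowP => i; rewrite mxE; apply/eqP.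
by have := x0 i (mem_index_enum i); rewrite /= mulf_eq0 orbb.
Qed.

(* The Householder reflection exchanging [e] and [v]. *)
Lemma reflection_exists (R : realFieldType) (n : nat) (e v : 'rV[R]_n) :
  e *m e^T = 1%:M -> v *m v^T = 1%:M ->
  exists2 H : 'M[R]_n, H *m H^T = 1%:M & e *m H = v.
Proof.
move=> ee vv; have [->|nev] := eqVneq v e.
  by exists 1%:M; rewrite ?trmx1 mulmx1.
set w := v - e; have w0 : w != 0 by rewrite subr_eq0.
have s0 := sqnorm_gt0 w0; set s := (w *m w^T) 0 0 in s0.
have ww : w *m w^T = s%:M by rewrite [LHS]mx11_scalar.
set t := (e *m v^T) 0 0.
have ev : e *m v^T = t%:M by rewrite [LHS]mx11_scalar.
have ve : v *m e^T = t%:M by rewrite -[LHS]trmxK trmx_mul trmxK ev tr_scalar_mx.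
have ew : e *m w^T = (t - 1)%:M.
  by rewrite /w linearB /= mulmxBr ev ee raddfB.
have sE : s = 2 - 2 * t.
  rewrite /s /w linearB /= mulmxBl !mulmxBr vv ve ev ee !mxE /= !mulr1n; lra.
(* Reflection in the hyperplane orthogonal to [w = v - e]. It is symmetric, hence its own inverse,
   and it sends [e] to [e + w = v] because [e *m w^T] is [t - 1 = - s / 2]. *)
exists (1%:M - (2 / s) *: (w^T *m w)).
  have -> : (1%:M - (2 / s) *: (w^T *m w))^T = 1%:M - (2 / s) *: (w^T *m w).
    by rewrite linearB /= linearZ /= trmx1 trmx_mul trmxK.
  rewrite mulmxBr mulmx1 mulmxBl mul1mx -scalemxAl -scalemxAr scalerA.
  rewrite mulmxA -[w^T *m w *m w^T]mulmxA ww mul_mx_scalar -scalemxAl scalerA.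
  have -> : 2 / s * (2 / s) * s = 2 / s + 2 / s by field; rewrite gt_eqF.
  by rewrite scalerDl opprB addrK subrK.
rewrite mulmxBr mulmx1 -scalemxAr mulmxA ew mul_scalar_mx scalerA.
have -> : 2 / s * (t - 1) = -1 by rewrite sE; field; rewrite -sE gt_eqF.
by rewrite scaleN1r opprK addrC subrK.
Qed.

Lemma unit_eigenvector (R : rcfType) (n : nat) (A : 'M[R]_n) (a : R) :
  root (char_poly A) a -> exists2 v : 'rV_n, v *m A = a *: v & v *m v^T = 1%:M.
Proof.
rewrite -eigenvalue_root_char => /eigenvalueP [v vA v0].
have s0 := sqnorm_gt0 v0; set s := (v *m v^T) 0 0 in s0.
exists ((Num.sqrt s)^-1 *: v).
  by rewrite -scalemxAl vA !scalerA mulrC.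
rewrite linearZ /= -scalemxAl -scalemxAr scalerA [v *m _]mx11_scalar -/s.
rewrite scale_scalar_mx -invfM -expr2 sqr_sqrtr ?(ltW s0) // mulVf //.
by rewrite gt_eqF.
Qed.

(* Deflation: a reflection moves a unit eigenvector for [lam 0] to the first
   basis vector, which splits off a 1x1 block.  The order of [lam] is kept. *)
Lemma symmetric_diagonalization (R : rcfType) (n : nat) (A : 'M[R]_n)
    (lam : 'I_n -> R) :
  A^T = A -> char_poly A = \prod_(i < n) ('X - (lam i)%:P) ->
  exists2 U : 'M[R]_n, U *m U^T = 1%:M &
    A = U^T *m diag_mx (\row_i lam i) *m U.
Proof.
elim: n A lam => [|n IHn] A lam symA charA.
  by exists 1%:M; rewrite ?trmx1 ?mulmx1 //; apply/matrixP => -[].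
have [|v vA vv] := @unit_eigenvector _ _ A (lam 0).
  by rewrite charA big_ord_recl rootM root_XsubC eqxx.
pose e : 'rV[R]_n.+1 := delta_mx 0 0.
have ee : e *m e^T = 1%:M.
  by rewrite trmx_delta mul_delta_mx; apply/matrixP => i j; rewrite !ord1 !mxE.
have [H HH eH] := reflection_exists ee vv.
have HtH := mulmx1C HH.
pose B : 'M[R]_(1 + n) := H *m A *m H^T.
have symB : B^T = B by rewrite /B !trmx_mul trmxK symA mulmxA.
(* This fixes the first row of [B]; symmetry then clears the first column as well. *)
have eB : e *m B = lam 0 *: e.
  by rewrite /B !mulmxA eH vA -eH -scalemxAl -mulmxA HH mulmx1.
have rowB j : B (lshift n 0) j = (j == lshift n 0)%:R * lam 0.
  have -> : lshift n 0 = 0 :> 'I_(1 + n) by exact: val_inj.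
  move/rowP/(_ j): eB; rewrite -rowE !mxE eqxx /= => ->.
  by rewrite mulrC.
have charB : char_poly B = char_poly A by exact: char_poly_similar.
have AE : A = H^T *m B *m H.
  by rewrite /B !mulmxA HtH mul1mx -!mulmxA HtH mulmx1.
clearbody B; have Bblock : B = block_mx (lam 0)%:M 0 0 (drsubmx B).
  have urB : ursubmx B = 0.
    by apply/rowP => j; rewrite !mxE rowB mul0r.
  have ulB : ulsubmx B = (lam 0)%:M.
    by apply/matrixP => i j; rewrite !ord1 !mxE rowB eqxx mul1r.
  rewrite -{1}[B]submxK ulB urB; congr block_mx.
  by rewrite -[LHS]trmxK trmx_dlsub symB urB trmx0.
have [||W WW BW] := IHn (drsubmx B) (fun i => lam (lift 0 i)).
- by rewrite trmx_drsub symB.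
(* The block form factors the characteristic polynomial of [B]; cancelling the nonzero factor
   ['X - (lam 0)%:P] leaves the hypothesis needed for the lower block. *)
- move: charB; rewrite charA big_ord_recl {1}Bblock /char_poly char_block_diag_mx det_ublock.
  rewrite [char_poly_mx _]mx11_scalar det_scalar1 !mxE eqxx mulr1n.
  by move/mulfI; apply; rewrite polyXsubC_eq0.
pose K : 'M[R]_(1 + n) := block_mx 1%:M 0 0 W.
have trK : K^T = block_mx 1%:M 0 0 W^T by rewrite tr_block_mx trmx1 !trmx0.
have KK : K *m K^T = 1%:M.
  rewrite trK mulmx_block !mulmx0 !mul0mx !addr0 !add0r mulmx1 WW.
  by rewrite -scalar_mx_block.
exists (K *m H).
  by rewrite trmx_mul -mulmxA [H *m _]mulmxA HH mul1mx.
have BE : B = K^T *m block_mx (lam 0)%:M 0 0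
    (diag_mx (\row_i lam (lift 0 i))) *m K.
  rewrite trK !mulmx_block !mulmx0 !mul0mx !addr0 !add0r mulmx1 !mul0mx mul1mx -BW.
  exact: Bblock.
have -> : diag_mx (\row_i lam i) = block_mx (lam 0)%:M 0 0
    (diag_mx (\row_i lam (lift 0 i))) :> 'M[R]_(1 + n).
  rewrite -diag_const_mx -diag_mx_row; congr diag_mx; apply/rowP => i.
  case: (split_ordP i) => k ->.
    by rewrite row_mxEl !mxE ord1; congr (lam _); exact: val_inj.
  by rewrite row_mxEr !mxE; congr (lam _); exact: val_inj.
by rewrite AE {1}BE trmx_mul !mulmxA.
Qed.

(** * Quadratic forms and Weyl's inequality *)

Lemma qform_diag (R : comPzRingType) (n : nat) (lam : 'I_n -> R)
    (x : 'rV[R]_n) :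
  (x *m diag_mx (\row_i lam i) *m x^T) 0 0 = \sum_i lam i * x 0 i ^+ 2.
Proof.
rewrite dot_rowE; apply: eq_bigr => i _.
by rewrite mul_mx_diag !mxE mulrAC mulrC expr2.
Qed.

(* Courant-Fischer by dimension count: the span of the first [i + 1]
   eigenvectors of [A] meets that of the last [n - i] eigenvectors of [B]. *)
Lemma weyl_le (R : rcfType) (n : nat) (A B : 'M[R]_n) (a b : 'I_n -> R)
    (c : R) :
  A^T = A -> B^T = B ->
  (forall i j : 'I_n, (i <= j)%N -> a j <= a i) ->
  (forall i j : 'I_n, (i <= j)%N -> b j <= b i) ->
  char_poly A = \prod_(i < n) ('X - (a i)%:P) ->
  char_poly B = \prod_(i < n) ('X - (b i)%:P) ->
  (forall x : 'rV[R]_n, (x *m (A - B) *m x^T) 0 0 <= c * (x *m x^T) 0 0) ->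
  forall i, a i <= b i + c.
Proof.
move=> symA symB mono_a mono_b charA charB leAB i.
have [U UU AE] := symmetric_diagonalization symA charA.
have [V VV BE] := symmetric_diagonalization symB charB.
(* The equation [y *m C = 0] encodes the intersection of the two spans: the columns [j > i] force
   [y 0 j = 0], and the columns [j < i] force the [j]-th coordinate of [y *m U *m V^T] to vanish.
   Column [i] imposes nothing, so [C] is singular and a nonzero [y] exists. *)
pose C := \matrix_(k, j) if (i < j)%N then (k == j)%:R
            else if (j < i)%N then (U *m V^T) k j else 0.
have /eqP/det0P [y y0 yC] : \det C = 0.
  rewrite -det_tr (expand_det_row _ i) big1 // => j _.
  by rewrite !mxE ltnn mul0r.
have yhi (j : 'I_n) : (i < j)%N -> y 0 j = 0.
  move=> ij; move/rowP/(_ j): yC; rewrite !mxE => <-.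
  rewrite (bigD1 j) //= !mxE ij eqxx mulr1 big1 ?addr0 // => k /negbTE kj.
  by rewrite !mxE ij kj mulr0.
(* [y] and [z] are the coordinates of the same vector [x] in the eigenbases formed by the rows of
   [U] and of [V]. *)
pose x := y *m U; pose z := x *m V^T.
have zlo (j : 'I_n) : (j < i)%N -> z 0 j = 0.
  move=> ji; have /rowP/(_ j) := yC; rewrite [RHS]mxE => <-.
  rewrite /z /x -mulmxA mxE [RHS]mxE; apply: eq_bigr => k _.
  by rewrite [C k j]mxE ltnNge (ltnW ji) ji.
have xE : x = z *m V by rewrite /z -mulmxA (mulmx1C VV) mulmx1.
have qA : (x *m A *m x^T) 0 0 = \sum_j a j * y 0 j ^+ 2.
  rewrite -qform_diag AE /x trmx_mul !mulmxA -[y *m U *m _]mulmxA UU mulmx1.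
  by rewrite -[_ *m U *m U^T]mulmxA UU mulmx1.
have qB : (x *m B *m x^T) 0 0 = \sum_j b j * z 0 j ^+ 2.
  rewrite -qform_diag BE xE trmx_mul !mulmxA -[z *m V *m _]mulmxA VV mulmx1.
  by rewrite -[_ *m V *m V^T]mulmxA VV mulmx1.
have xy : (x *m x^T) 0 0 = \sum_j y 0 j ^+ 2.
  rewrite /x trmx_mul mulmxA -[y *m U *m _]mulmxA UU mulmx1 dot_rowE.
  by under eq_bigr do rewrite -expr2.
have xz : (x *m x^T) 0 0 = \sum_j z 0 j ^+ 2.
  rewrite xE trmx_mul mulmxA -[z *m V *m _]mulmxA VV mulmx1 dot_rowE.
  by under eq_bigr do rewrite -expr2.
have s0 : 0 < (x *m x^T) 0 0.
  rewrite xy; have := sqnorm_gt0 y0; rewrite dot_rowE.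
  by under eq_bigr do rewrite -expr2.
(* Only coordinates [j <= i] of [y] survive, where [a j >= a i]; dually, only coordinates [j >= i]
   of [z] survive, where [b j <= b i]. *)
have loA : a i * (x *m x^T) 0 0 <= (x *m A *m x^T) 0 0.
  rewrite qA xy mulr_sumr; apply: ler_sum => j _.
  have [ji|ij] := leqP j i; first by rewrite ler_wpM2r ?sqr_ge0 ?mono_a.
  by rewrite yhi // expr0n /= !mulr0.
have upB : (x *m B *m x^T) 0 0 <= b i * (x *m x^T) 0 0.
  rewrite qB xz mulr_sumr; apply: ler_sum => j _.
  have [ij|ji] := leqP i j; first by rewrite ler_wpM2r ?sqr_ge0 ?mono_b.
  by rewrite zlo // expr0n /= !mulr0.
have := leAB x; rewrite mulmxBr mulmxBl !mxE => leABx.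
rewrite -(ler_pM2r s0) mulrDl; move: loA upB leABx; rewrite !mxE; lra.
Qed.

(** Each off-diagonal term is at most [c / 2] times the sum of the two squares involved. Every
    square occurs in [n - 1] such terms as a row index and in [n - 1] as a column index, whence the
    factor [n%:R - 1]. *)
Lemma qform_zero_diag_le (R : realFieldType) (n : nat) (E : 'M[R]_n) (c : R)
    (x : 'rV[R]_n) :
  (forall i, E i i = 0) -> (forall i j, `|E i j| <= c) ->
  (x *m E *m x^T) 0 0 <= c * (n%:R - 1) * (x *m x^T) 0 0.
Proof.
move=> E0 Ec; rewrite !dot_rowE.
set S := \sum_i x 0 i * x 0 i.
(* The indicator makes the summand vanish at [j = i], matching the zero diagonal of [E], so the two
   double sums can be compared term by term. *)
have -> : c * (n%:R - 1) * S = \sum_i \sum_j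
    (c / 2 * (x 0 j ^+ 2 + x 0 i ^+ 2) - (j == i)%:R * (c * x 0 j ^+ 2)).
  transitivity (\sum_i (c / 2 * (S + n%:R * x 0 i ^+ 2) - c * x 0 i ^+ 2)).
    rewrite sumrB -!mulr_sumr big_split /= -mulr_sumr sumr_const card_ord.
    have -> : \sum_i x 0 i ^+ 2 = S by apply: eq_bigr => i _; rewrite expr2.
    by rewrite -mulr_natl; field.
  apply: eq_bigr => i _; rewrite sumrB -mulr_sumr big_split /= sumr_const card_ord.
  rewrite -[x 0 i ^+ 2 *+ n]mulr_natl; congr (c / 2 * (_ + _) - _).
  rewrite (bigD1 i) //= eqxx mul1r big1 ?addr0 // => j /negbTE ->.
  by rewrite mul0r.
apply: ler_sum => i _; rewrite mxE mulr_suml; apply: ler_sum => j _.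
have [->|_] := eqVneq j i; first by rewrite E0 mulr0 mul0r mul1r; lra.
have := Ec j i; rewrite mul0r subr0 ler_norml => /andP [E1 E2].
(* Four times the gap between the two terms is the sum of these two nonnegative products, whatever
   the sign of [E j i]. *)
have := mulr_ge0 (_ : 0 <= c - E j i) (sqr_ge0 (x 0 j + x 0 i)).
have := mulr_ge0 (_ : 0 <= c + E j i) (sqr_ge0 (x 0 j - x 0 i)).
move=> /(_ ltac:(lra)) h1 /(_ ltac:(lra)) h2; nra.
Qed.

(** * Inner products of unit vectors and spectra of Gram matrices *)

Lemma dotE (R : realType) (n : nat) (u v : 'cV[R]_n) :
  dot u v = \sum_k u k 0 * v k 0.
Proof. by rewrite /dot mxE; apply: eq_bigr => k _; rewrite mxE. Qed.

Lemma l2norm_dot (R : realType) (n : nat) (u : 'cV[R]_n) :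
  l2norm u = 1 -> dot u u = 1.
Proof.
rewrite dotE /l2norm => u1; rewrite -[RHS](expr1n _ 2) -u1 sqr_sqrtr.
  by apply: eq_bigr => k _; rewrite expr2.
by apply: sumr_ge0 => k _; exact: sqr_ge0.
Qed.

(** Cauchy-Schwarz for unit vectors: the squared norms of [u + v] and [u - v] are [2 + 2 * dot u v]
    and [2 - 2 * dot u v], both nonnegative. *)
Lemma dot_unit_le (R : realType) (n : nat) (u v : 'cV[R]_n) :
  l2norm u = 1 -> l2norm v = 1 -> `|dot u v| <= 1.
Proof.
move=> /l2norm_dot + /l2norm_dot; rewrite !dotE => uu vv.
have h (s : R) : 0 <= \sum_k (u k 0 + s * v k 0) ^+ 2.
  by apply: sumr_ge0 => k _; exact: sqr_ge0.
have hE (s : R) : \sum_k (u k 0 + s * v k 0) ^+ 2 =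
    1 + 2 * s * (\sum_k u k 0 * v k 0) + s ^+ 2.
  transitivity (\sum_k u k 0 * u k 0 + 2 * s * (\sum_k u k 0 * v k 0) +
                s ^+ 2 * \sum_k v k 0 * v k 0); last by rewrite uu vv mulr1.
  rewrite !mulr_sumr -!big_split /=.
  by apply: eq_bigr => k _; ring.
have h1 := h 1; have h2 := h (-1); rewrite !hE in h1 h2.
by rewrite ler_norml; apply/andP; split; lra.
Qed.

Lemma gramE (R : realType) (n N : nat) (phi : 'I_N -> 'cV[R]_n) i j :
  gram phi i j = dot (phi i) (phi j).
Proof. by rewrite dotE mxE; apply: eq_bigr => k _; rewrite !mxE. Qed.

Lemma tr_gram (R : realType) (n N : nat) (phi : 'I_N -> 'cV[R]_n) :
  (gram phi)^T = gram phi.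
Proof. by rewrite /gram trmx_mul trmxK. Qed.

(** In an orthonormal eigenbasis [U], the eigenvalue [lam i] is the [i]-th diagonal entry of
    [U *m gram phi *m U^T], which is the squared norm of row [i] of [U *m (cols_mx phi)^T]. *)
Lemma gram_eigenvalue_ge0 (R : realType) (n N : nat) (phi : 'I_N -> 'cV[R]_n)
    (lam : 'I_N -> R) :
  ordered_eigenvalues (gram phi) lam -> forall i, 0 <= lam i.
Proof.
move=> [_ charG] i.
have [U UU GE] := symmetric_diagonalization (tr_gram phi) charG.
have : (U *m gram phi *m U^T) i i = lam i.
  rewrite GE !mulmxA UU mul1mx -mulmxA UU mulmx1.
  by rewrite !mxE eqxx.
move=> <-; rewrite /gram mulmxA -mulmxA.
have -> : cols_mx phi *m U^T = (U *m (cols_mx phi)^T)^T.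
  by rewrite trmx_mul trmxK.
rewrite mxE; apply: sumr_ge0 => k _.
by rewrite [_^T k i]mxE -expr2 sqr_ge0.
Qed.

(** Both sides equal the trace: it is invariant under the orthogonal change of basis, and the
    diagonal entries are squared norms of unit vectors. *)
Lemma gram_eigenvalue_sum (R : realType) (n N : nat) (phi : 'I_N -> 'cV[R]_n)
    (lam : 'I_N -> R) :
  (forall i, l2norm (phi i) = 1) ->
  ordered_eigenvalues (gram phi) lam -> \sum_i lam i = N%:R.
Proof.
move=> phi1 [_ charG].
have [U UU GE] := symmetric_diagonalization (tr_gram phi) charG.
have : \tr (gram phi) = \sum_i lam i.
  rewrite GE mxtrace_mulC mulmxA UU mul1mx mxtrace_diag.
  by apply: eq_bigr => i _; rewrite mxE.
move=> <-; rewrite /mxtrace (eq_bigr (fun=> 1)) => [|i _].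
  by rewrite sumr_const card_ord.
by rewrite gramE l2norm_dot.
Qed.

(** * The entrywise error and the eigenvalue bounds *)

Lemma gram_error_ge (R : realType) (p d N : nat)
    (phis : 'I_N -> 'cV[R]_p) (phi : 'I_N -> 'cV[R]_d) i j :
  `|dot (phi i) (phi j) - dot (phis i) (phis j)| <= gram_error phis phi.
Proof.
apply: le_trans (le_bigmax _ _ i).
exact: (le_bigmax _ (fun j => `|dot (phi i) (phi j) - dot (phis i) (phis j)|)).
Qed.

(** This symmetry lets a one-sided eigenvalue bound, applied with the two families exchanged, supply
    the other side. *)
Lemma gram_errorC (R : realType) (p d N : nat)
    (phis : 'I_N -> 'cV[R]_p) (phi : 'I_N -> 'cV[R]_d) :
  gram_error phi phis = gram_error phis phi.
Proof. by apply: eq_bigr => i _; apply: eq_bigr => j _; rewrite distrC. Qed.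

Lemma gram_error_bounds (R : realType) (p d N : nat)
    (phis : 'I_N -> 'cV[R]_p) (phi : 'I_N -> 'cV[R]_d) :
  (forall i, l2norm (phis i) = 1) -> (forall i, l2norm (phi i) = 1) ->
  0 <= gram_error phis phi <= 2.
Proof.
move=> phis1 phi1; rewrite bigmax_ge_id /=.
apply: bigmax_le => // i _; apply: bigmax_le => // j _.
apply: le_trans (ler_normB _ _) _.
by rewrite -[2]/(1 + 1) lerD ?dot_unit_le.
Qed.

Lemma gram_eigenvalue_le (R : realType) (p d N : nat)
    (phis : 'I_N -> 'cV[R]_p) (phi : 'I_N -> 'cV[R]_d)
    (lams lam : 'I_N -> R) :
  (forall i, l2norm (phis i) = 1) -> (forall i, l2norm (phi i) = 1) ->
  ordered_eigenvalues (gram phis) lams -> ordered_eigenvalues (gram phi) lam ->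
  forall i, lam i <= lams i + gram_error phis phi * (N%:R - 1).
Proof.
move=> phis1 phi1 [mono_s char_s] [mono char_].
apply: (weyl_le (tr_gram phi) (tr_gram phis)) => // x.
have EE i j : (gram phi - gram phis) i j =
    dot (phi i) (phi j) - dot (phis i) (phis j).
  by rewrite -!gramE mxE [X in _ + X]mxE.
by apply: qform_zero_diag_le => [i|i j]; rewrite EE ?gram_error_ge // !l2norm_dot ?subrr.
Qed.

Theorem lemma2 (R : realType) (N d p : nat)
    (hN : (1 <= N)%N) (hd : (1 <= d)%N) (hp : (N <= p)%N)
    (sim : rel 'I_N) (sim_equiv : equivalence_rel sim)
    (phis : 'I_N -> 'cV[R]_p)
    (phis_norm : forall i, l2norm (phis i) = 1)
    (phis_dot : forall i j,
      dot (phis i) (phis j) = if sim i j then 1 else 0)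
    (phi : 'I_N -> 'cV[R]_d)
    (phi_norm : forall i, l2norm (phi i) = 1)
    (lams lam : 'I_N -> R)
    (lams_eig : ordered_eigenvalues (gram phis) lams)
    (lam_eig : ordered_eigenvalues (gram phi) lam) :
  let eps := gram_error phis phi in
  let delta (i : 'I_N) := lam i - lams i in
  let bound := Num.sqrt (N%:R * (N%:R - 1)) * eps in
  (forall i, 0 <= lams i /\ 0 <= lam i) /\
  0 <= eps <= 2 /\
  (forall i, - bound <= delta i <= bound) /\
  \sum_(i < N) delta i = 0.
Proof.
move=> eps delta bound.
have eps_bounds := gram_error_bounds phis_norm phi_norm.
have /andP [eps0 _] := eps_bounds.
split; first by move=> i; split; [exact: (gram_eigenvalue_ge0 lams_eig)
                                 | exact: (gram_eigenvalue_ge0 lam_eig)].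
split=> //; split; last first.
  by rewrite sumrB (gram_eigenvalue_sum phi_norm lam_eig)
    (gram_eigenvalue_sum phis_norm lams_eig) subrr.
have N1 : 0 <= N%:R - 1 :> R by rewrite subr_ge0 ler1n.
(* As [N%:R - 1] is nonnegative, it is the root of its own square, and that square is at most
   [N%:R * (N%:R - 1)]. *)
have le_bound : eps * (N%:R - 1) <= bound.
  rewrite mulrC ler_wpM2r // -[leLHS]ger0_norm // -sqrtr_sqr ler_wsqrtr //.
  by rewrite expr2 ler_wpM2r // lerBlDr lerDl.
move=> i; rewrite /delta.
have upper := gram_eigenvalue_le phis_norm phi_norm lams_eig lam_eig i.
have lower := gram_eigenvalue_le phi_norm phis_norm lam_eig lams_eig i.
rewrite gram_errorC in lower; rewrite -/eps in upper lower.
by apply/andP; split; lra.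
Qed.
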